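(* Let $k\geq 3$ be an integer and let $D$ be a strongly connected digraph. If $\chi(D)>(2k-2)(2k-3)$, then $D$ contains a subdivision of $B(k,1;1)$.
   Context: Digraphs are finite, without loops or parallel arcs (opposite arcs allowed). $\chi(D)$ is the chromatic number of the underlying undirected graph of $D$. A digraph is strongly connected if every vertex can reach every other vertex by a directed path. For positive integers $k_1,k_2,k_3$, a digraph $D$ contains a subdivision of $B(k_1,k_2;k_3)$ if there exist distinct vertices $x,y$ of $D$ and three pairwise internally vertex-disjoint directed paths in $D$: two from $x$ to $y$, of lengths (numbers of arcs) at least $k_1$ and at least $k_2$ respectively, and one from $y$ to $x$ of length at least $k_3$. *)

(* Defs.v *)
(* A digraph on a finite vertex type T is an arc relation
   a : rel T (a x y = there is an arc x -> y).  A relation automatically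
   excludes parallel arcs and allows opposite arcs; loops are excluded by
   the hypothesis [irreflexive a] in the theorem. *)
From mathcomp Require Import all_boot.
Set Implicit Arguments. Unset Strict Implicit. Unset Printing Implicit Defensive.

Definition und_adj (T : finType) (a : rel T) : rel T :=
  fun x y => (x != y) && (a x y || a y x).

Definition colorable (T : finType) (a : rel T) (m : nat) : bool :=
  [exists c : {ffun T -> 'I_m}, forall x, forall y,
     und_adj a x y ==> (c x != c y)].

Lemma colorable_card (T : finType) (a : rel T) : exists m, colorable a m.
Proof.
exists #|T|; apply/existsP; exists [ffun x => enum_rank x].
apply/forallP => x; apply/forallP => y; apply/implyP => /andP[nxy _].
rewrite !ffunE; by apply: contra nxy => /eqP /enum_rank_inj ->.
Qed.

Definition chi (T : finType) (a : rel T) : nat :=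
  ex_minn (colorable_card a).

(* [:: x & p] is a directed path from x to y (no repeated vertices);
   its length (number of arcs) is size p *)
Definition dipath (T : finType) (a : rel T) (x y : T) (p : seq T) : Prop :=
  [/\ path a x p, last x p = y & uniq (x :: p)].

(* internal vertices of the path [:: x & p] (p without its last vertex) *)
Definition interior (T : Type) (p : seq T) : seq T := take (size p).-1 p.

Definition int_disjoint (T : finType) (p q : seq T) : Prop :=
  forall v, v \in interior p -> v \notin interior q.

Definition contains_subdiv_B (T : finType) (a : rel T) (k1 k2 k3 : nat) : Prop :=
  exists (x y : T) (p1 p2 p3 : seq T),
    [/\ x != y,
        dipath a x y p1 /\ k1 <= size p1,
        dipath a x y p2 /\ k2 <= size p2,
        dipath a y x p3 /\ k3 <= size p3 &
        [/\ int_disjoint p1 p2, int_disjoint p1 p3 & int_disjoint p2 p3]].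

Definition strongly_connected (T : finType) (a : rel T) : Prop :=
  forall x y : T, connect a x y.

(* Main.v *)
(** Suppose that [a] contains no subdivision of B(k,1;1). An ear of a dicycle
    [C] from [u] to [v], and the arc of [C] from [u] to [v], then both have length less than [k].
    Take a maximal family of dicycles of length at least 2k-2 that pairwise
    share at most one vertex. If two members meet in [u], no dipath avoiding
    [u] joins one to the other; hence the members form a tree-like
    structure, every arc inside a connected component of their union lies in a single
    member, and (2k-2)-colourings of the members glue together. A dicycle of
    length at least 2k-2 in the digraph obtained by contracting the components
    would lift to a dicycle that could be added to the family, so by Bondy's
    theorem the contracted digraph is (2k-3)-colourable. The product of the two
    colourings is proper. *)
Require Import Defs.
From Stdlib Require Import Classical_Prop.
From mathcomp Require Import all_boot all_order perm ssralg ssrnum ssrint intdiv zify.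
Set Implicit Arguments. Unset Strict Implicit. Unset Printing Implicit Defensive.

(** * Bondy's theorem: a strong digraph whose dicycles have length at most [l] is [l]-colourable *)

Section Bondy.
Import Order.TTheory GRing.Theory Num.Theory.
Local Open Scope ring_scope.
Variable T : finType.
Implicit Types (a : rel T) (w g : T -> T -> int) (x y : T) (p q : seq T).

Fixpoint weight w x p : int :=
  if p is y :: p' then w x y + weight w y p' else 0.

Lemma weight_cat w x p q :
  weight w x (p ++ q) = weight w x p + weight w (last x p) q.
Proof.
by elim: p x => [|y p IHp] x /=; rewrite ?add0r // IHp addrA.
Qed.

Lemma potential_exists a w : irreflexive a ->
  (forall x p, cycle a (x :: p) -> uniq (x :: p) -> weight w x (rcons p x) <= 0) ->
  exists f : T -> int, forall x y, a x y -> f x + w x y <= f y.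
Proof.
move=> irr neg.
(* Bounded sequences form a finite type, so a heaviest dipath from each vertex can be picked. *)
pose P x (t : #|T|.-bseq T) := path a x t && uniq (x :: t).
have P0 x : P x [bseq] by [].
pose m x := [arg max_(t > [bseq] | P x t) weight w x t]%O.
have mP x : P x (m x) /\ forall t, P x t -> weight w x t <= weight w x (m x).
  by rewrite /m; case: arg_maxP.
have max_m x p : path a x p -> uniq (x :: p) -> weight w x p <= weight w x (m x).
  move=> ap up; have sz_p : (size p <= #|T|)%N.
    by rewrite -(card_uniqP (andP up).2); exact: max_card.
  by have := (mP x).2 (Bseq sz_p); rewrite /P /= ap -/(uniq (x :: p)) up; apply.
exists (fun x => - weight w x (m x)) => x y axy.
have [/andP[ap up] _] := mP y.
suff: w x y + weight w y (m y) <= weight w x (m x) by lia.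
move: (m y : seq T) ap up => p ap up.
have nxy : x != y by apply: contraTneq axy => ->; rewrite irr.
have [xp|xp] := boolP (x \in p); last first.
  have := @max_m x (y :: p); rewrite /= axy ap => -> //.
  by rewrite -/(uniq (y :: p)) up inE negb_or nxy xp.
case/splitPr: xp ap up => p1 p2.
rewrite cat_path /= => /and3P[ap1 ax1 ap2] up.
have/andP[uxp _] : uniq (x :: y :: p1) && uniq (x :: p2).
  by move: up; rewrite /= mem_cat !cat_uniq !inE /= !negb_or eq_sym; lia.
have := @neg x (y :: p1); rewrite /= axy rcons_path ap1 ax1 => /(_ isT uxp).
have := @max_m x p2 ap2.
have -> : uniq (x :: p2) by move: up; rewrite /= cat_uniq /= => /and4P[_ _ _ ->].
move=> /(_ isT).
rewrite weight_cat /= -cats1 weight_cat /=; lia.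
Qed.

Lemma weight_sub w g x p :
  weight (fun x y => w x y - g x y) x p = weight w x p - weight g x p.
Proof. by elim: p x => [|y p IHp] x //=; rewrite IHp; lia. Qed.

Lemma weight_affine g (l : int) x p :
  weight (fun x y => 1 - l * g x y) x p = (size p)%:Z - l * weight g x p.
Proof. by elim: p x => [|y p IHp] x //=; rewrite ?IHp; nia. Qed.

Lemma weight_telescope (f : T -> int) x p :
  weight (fun x y => f y - f x) x p = f (last x p) - f x.
Proof. by elim: p x => [|y p IHp] x //=; rewrite ?IHp; lia. Qed.

Definition step x y : T -> T -> int := fun u v => ((u == x) && (v == y))%:Z.

Lemma weight_step_ge0 x y z p : 0 <= weight (step x y) z p.
Proof. by elim: p z => [|v p IHp] z //=; apply: addr_ge0. Qed.

Lemma weight_step_le1 x y z p :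
  uniq (z :: p) -> weight (step x y) z (rcons p z) <= 1.
Proof.
have le_count q v : weight (step x y) v q <= (count_mem x (belast v q))%:Z.
  elim: q v => [|v' q IHq] v //=; have := IHq v'; rewrite /step;
  case: (v == x); case: (v' == y) => /=; lia.
move=> up; apply: le_trans (le_count _ _) _.
by rewrite belast_rcons count_uniq_mem // lez_nat leq_b1.
Qed.

(** Meant for a nonnegative slack: on a walk that uses an arc, the slack of this arc is at most the
    total slack. *)
Lemma weight_ge_step a w x y z p : (forall u v, a u v -> 0 <= w u v) ->
  path a z p -> 0 < weight (step x y) z p -> w x y <= weight w z p.
Proof.
move=> w_ge0; elim: p z => [|v p IHp] z //= /andP[azv ap].
have w0 : 0 <= weight w v p.
  elim: p v {IHp azv} ap => [|v' p IHp] v //= /andP[/w_ge0 ? /IHp]; lia.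
have := w_ge0 _ _ azv; have {azv} := IHp _ ap; move: w0; rewrite {2}/step.
have [->|_] := eqVneq z x; have [->|_] := eqVneq v y; rewrite ?add0r /=.
all: lia.
Qed.

(* Take [g] minimizing the total weight of one fixed dicycle through each arc: if an arc lay on no dicycle of weight [1], its weight could be lowered. *)
Lemma tight_weighting a : irreflexive a -> strongly_connected a ->
  exists g : T -> T -> int,
    (forall x p, cycle a (x :: p) -> uniq (x :: p) -> 1 <= weight g x (rcons p x)) /\
    (forall x y, a x y -> exists z p, [/\ cycle a (z :: p), uniq (z :: p),
       weight g z (rcons p z) = 1 & 0 < weight (step x y) z (rcons p z)]).
Proof.
move=> irr strong.
pose good g := forall x p, cycle a (x :: p) -> uniq (x :: p) -> 1 <= weight g x (rcons p x).
have ret (e : T * T) : exists q, a e.1 e.2 ->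
    [/\ cycle a (e.1 :: q), uniq (e.1 :: q) & exists q', rcons q e.1 = e.2 :: q'].
  case: e => x y /=; case/connectP: (strong y x) => p0 ap0 Ex.
  case/shortenP: ap0 Ex => p ap up _ Ex; exists (belast y p) => axy.
  have Ep : rcons (belast y p) x = y :: p by rewrite [in LHS]Ex -lastI.
  split; [by rewrite /= Ep /= axy | | by exists p].
  by rewrite -rcons_uniq Ep.
have [q qP] := fin_all_exists ret.
pose M g := \sum_(e : T * T | a e.1 e.2) weight g e.1 (rcons (q e) e.1).
have M_ge0 g : good g -> 0 <= M g.
  move=> gg; apply: sumr_ge0 => e ae; have [cq uq _] := qP e ae.
  by have := gg _ _ cq uq; lia.
pose dec g x y u v := g u v - step x y u v.
have M_dec g x y : a x y -> M (dec g x y) < M g.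
  move=> axy; rewrite /M (bigD1 (x, y)) //= [ltRHS](bigD1 (x, y)) //=.
  apply: ltr_leD; last first.
    by apply: ler_sum => e _; rewrite weight_sub; have := weight_step_ge0 x y e.1 (rcons (q e) e.1); lia.
  have [_ _ /= [q' ->]] := qP (x, y) axy.
  by rewrite weight_sub /=; have := weight_step_ge0 x y y q'; rewrite /step !eqxx /=; lia.
(* [M] is a nonnegative integer on good weightings and every lowering decreases it, so the descent
   stops at a weighting that no lowering keeps good. *)
have [g [gg min_g]] : exists g, good g /\ forall x y, a x y -> ~ good (dec g x y).
  (* The constant weight 1, written in the shape that [weight_affine] expects. *)
  pose g0 : T -> T -> int := fun _ _ => 1 - 0 * 0.
  have good0 : good g0.
    by move=> x p _ _; rewrite weight_affine size_rcons; lia.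
  have [n le_n] : exists n : nat, M g0 <= n%:Z by exists `|M g0|%N; lia.
  elim: n g0 good0 le_n => [|n IHn] g gg le_n; apply: NNPP => no_min; case: no_min.
    exists g; split=> // x y axy gd; have := M_dec g _ _ axy; have := M_ge0 _ gd; lia.
  apply: NNPP => no_min; case: (no_min); exists g; split=> // x y axy gd.
  by apply: no_min; apply: (IHn _ gd); have := M_dec g _ _ axy; lia.
(* Lowering the arc makes some dicycle lighter than 1; by integrality this dicycle had weight
   exactly 1 and uses the arc. *)
exists g; split=> // x y axy; apply: NNPP => no_cyc; case: (min_g _ _ axy) => z p cp up.
rewrite /dec weight_sub leNgt; apply/negP => lt1; case: no_cyc; exists z, p.
have := gg _ _ cp up; have := weight_step_le1 x y up; have := weight_step_ge0 x y z (rcons p z).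
by split=> //; lia.
Qed.

(* With weights [1 - l * g] no dicycle is positive, so a potential [f] exists; tightness of [g] confines
   [f y - f x + l * g x y] to the range from [1] to [l - 1] on every arc, and [f] modulo [l] is proper. *)
Lemma coloring_of_short_dicycles a (l : nat) : irreflexive a -> strongly_connected a ->
  (0 < l)%N -> (forall c, ucycle a c -> (size c <= l)%N) ->
  exists f : T -> 'I_l, forall x y, a x y -> f x != f y.
Proof.
move=> irr strong l_gt0 short.
have [g [gg tight]] := tight_weighting irr strong.
pose w u v : int := 1 - l%:Z * g u v.
have [|f fP] := @potential_exists a w irr.
  move=> x p cp up; rewrite weight_affine size_rcons.
  have := gg _ _ cp up; have := short (x :: p); rewrite /ucycle cp up => /(_ isT) /=; nia.
have f_lt x y : a x y -> f y - f x <= l%:Z - 1 - l%:Z * g x y.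
  move=> axy; have [z [p [cp up tp sp]]] := tight _ _ axy.
  have := @weight_ge_step a (fun u v => f v - f u - w u v) x y z (rcons p z).
  rewrite weight_sub weight_telescope last_rcons weight_affine size_rcons tp.
  (* Without loops the tight dicycle has length at least 2, which improves the bound from [l] to
     [l - 1]. *)
  have : (0 < size p)%N by case: p cp {up tp sp} => //=; rewrite irr.
  have w_le u v : a u v -> 0 <= f v - f u - w u v by move=> /fP; lia.
  by move=> p_gt0 /(_ w_le cp sp); rewrite /w; lia.
have modP x : (`|(f x %% l)%Z| < l)%N.
  by have := @ltz_mod (f x) l; have := @modz_ge0 (f x) l; lia.
exists (fun x => Ordinal (modP x)) => x y axy; apply/eqP => -[].
have := f_lt _ _ axy; have := fP _ _ axy; rewrite /w => ge_f le_f eq_mod.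
have {}eq_mod : (f x %% l)%Z = (f y %% l)%Z.
  by have := @modz_ge0 (f x) l; have := @modz_ge0 (f y) l; lia.
have := divz_eq (f x) l; have := divz_eq (f y) l; rewrite eq_mod.
move: (f y %/ l)%Z (f x %/ l)%Z (g x y) ge_f le_f => qy qx gxy ge_f le_f Ey Ex.
(* Equal residues put a multiple of [l] strictly between 0 and [l]. *)
have : 1 <= l%:Z * (qy - qx + gxy) <= l%:Z - 1.
  rewrite Ey Ex in ge_f le_f; clear -ge_f le_f.
  by move: (f y %% l)%Z ge_f le_f => r ge_f le_f; apply/andP; split; lia.
move: (qy - qx + gxy) => t; clear -l_gt0 => /andP[lt_ge1 lt_le].
by have [t_le|t_gt] := lerP t 0; nia.
Qed.

End Bondy.

(** * Ears of dicycles *)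

Section Dicycles.
Variables (T : finType) (a : rel T).
Implicit Types (A B C : {set T}) (x y z u v : T) (p q s c : seq T).

(** A dicycle is recorded by its vertex set only, so that families of dicycles live in a finite
    type; the tuple makes the predicate boolean. *)
Definition dicycle A :=
  [exists t : #|A|.-tuple T, [&& cycle a t, uniq t & A == [set x in t]]].

Lemma dicycleP A :
  reflect (exists2 c, ucycle a c & A = [set x in c]) (dicycle A).
Proof.
apply: (iffP existsP) => [[t /and3P[ct ut /eqP->]]|[c /andP[cc uc] ->]].
  by exists t; rewrite // /ucycle ct.
have sz_c : size c == #|[set x in c]| by rewrite cardsE (card_uniqP uc).
by exists (Tuple sz_c); rewrite /= cc uc eqxx.
Qed.

(** [s] and [s'] are the interiors of the two arcs into which [u] and [v] cut one dicycle on [A]. *)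
Definition cycle_arcs A u v s s' :=
  [/\ path a u (rcons s v), path a v (rcons s' u),
      uniq (u :: s ++ v :: s') & A =i u :: s ++ v :: s'].

Lemma dicycle_arcs A u v : dicycle A -> u \in A -> v \in A -> u != v ->
  exists s s', cycle_arcs A u v s s'.
Proof.
case/dicycleP=> c /andP[cc uc] ->; rewrite !inE => uc_ vc_ nuv.
case/rot_to: uc_ => i c' Ec.
have vc' : v \in c' by move: vc_; rewrite -(mem_rot i) Ec inE eq_sym (negPf nuv).
have {}cc : cycle a (u :: c') by rewrite -Ec rot_cycle.
have {}uc : uniq (u :: c') by rewrite -Ec rot_uniq.
have Em : [set x in c] =i u :: c' by move=> x; rewrite inE -Ec mem_rot.
case/splitPr: vc' cc uc Em => s s' cc uc Em; exists s, s'; split=> //.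
  by rewrite rcons_path; move: cc; rewrite /= rcons_cat cat_path /= => /and3P[-> ->].
by move: cc; rewrite /= rcons_cat cat_path /= => /and3P[].
Qed.

Lemma cycle_arcs_sym A u v s s' : cycle_arcs A u v s s' -> cycle_arcs A v u s' s.
Proof.
have perm_vu : perm_eq (u :: s ++ v :: s') (v :: s' ++ u :: s).
  by rewrite -[u :: _ ++ _]/((u :: s) ++ (v :: s')) perm_catC.
case=> au av uq Em; split=> //; first by rewrite -(perm_uniq perm_vu).
by move=> x; rewrite Em (perm_mem perm_vu).
Qed.

Lemma cycle_arcs_size A u v s s' : cycle_arcs A u v s s' -> #|A| = size s + size s' + 2.
Proof.
by case=> _ _ uq /eq_card->; rewrite (card_uniqP uq) /= size_cat /=; lia.
Qed.

(** Strong induction on the length: a simple path with an interior vertex in [X] is cut down to the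
    part after it, one with an interior vertex in [Y] to the part before it. *)
Lemma ear_extract (X Y : pred T) x p :
    path a x p -> X x -> Y (last x p) ->
    (forall z, z \in x :: p -> X z -> ~~ Y z) ->
  exists x' q y, [/\ path a x' (rcons q y), uniq (x' :: rcons q y),
    X x' && Y y, {in q, forall z, ~~ X z && ~~ Y z} &
    {subset x' :: rcons q y <= x :: p}].
Proof.
elim/ltn_ind: {p}(size p) {-2}p (erefl (size p)) x => n IHn p0 sz_p0 x ap0.
case/shortenP: ap0 => p ap up sub_p Xx Yl XY.
have sz_p : size p <= n.
  by rewrite -sz_p0 uniq_leq_size //; case/andP: up.
have {sub_p}sub_p : {subset x :: p <= x :: p0}.
  by move=> z; rewrite !inE => /predU1P[->|/sub_p->]; rewrite ?eqxx ?orbT.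
suff: exists x' q y, [/\ path a x' (rcons q y), uniq (x' :: rcons q y),
    X x' && Y y, {in q, forall z, ~~ X z && ~~ Y z} &
    {subset x' :: rcons q y <= x :: p}].
  case=> x' [q [y [h1 h2 h3 h4 h5]]]; exists x', q, y; split=> // z /h5; exact: sub_p.
have {}XY z : z \in x :: p -> X z -> ~~ Y z by move/sub_p/XY.
clear p0 sub_p sz_p0.
case/lastP: p sz_p ap up Yl XY => [|q y] sz_p ap up Yl XY.
  by have := XY x; rewrite mem_head Yl => /(_ isT Xx).
have [/hasP[z zq /orP[Yz|Xz]]|/hasPn notXY] := boolP (has (fun z => Y z || X z) q); last first.
- exists x, q, y; split=> //; first by rewrite Xx -(last_rcons x q y).
  by move=> z /notXY; rewrite negb_or andbC.
- case/splitPr: zq sz_p ap up Yl XY => q1 q2 sz_p ap up Yl XY.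
  have [|||||x' [q' [y' [h1 h2 h3 h4 h5]]]] := IHn (size (rcons q2 y)) _ _ erefl z.
  - by move: sz_p; rewrite !size_rcons size_cat /=; lia.
  - by move: ap; rewrite rcons_cat cat_path /= => /and3P[].
  - by [].
  - by move: Yl; rewrite !last_rcons.
  - move=> z' z'q; apply: XY; rewrite rcons_cat inE mem_cat rcons_cons z'q; by rewrite !orbT.
  exists x', q', y'; split=> // z' /h5 z'q.
  by rewrite rcons_cat inE mem_cat rcons_cons z'q !orbT.
case/splitPr: zq sz_p ap up Yl XY => q1 q2 sz_p ap up Yl XY.
have sub_q : {subset x :: rcons q1 z <= x :: rcons (q1 ++ z :: q2) y}.
  by move=> z'; rewrite !(inE, mem_rcons, mem_cat) => /or3P[]->; rewrite ?orbT.
have [|||||x' [q' [y' [h1 h2 h3 h4 h5]]]] := IHn (size (rcons q1 z)) _ _ erefl x.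
- by move: sz_p; rewrite !size_rcons size_cat /=; lia.
- by rewrite rcons_path; move: ap; rewrite rcons_cat cat_path /= => /and3P[-> ->].
- by [].
- by rewrite last_rcons.
- by move=> z' /sub_q /XY.
by exists x', q', y'; split=> // z' /h5 /sub_q.
Qed.

Variable k : nat.
Hypothesis noB : ~ contains_subdiv_B a k 1 1.

(** The lists are the interiors of the three dipaths, so [size p1 + 1] is the length of the first
    one. *)
Lemma noB_short u v p1 p2 p3 :
    path a u (rcons p1 v) -> path a u (rcons p2 v) -> path a v (rcons p3 u) ->
  uniq [:: u, v & p1 ++ p2 ++ p3] -> size p1 + 1 < k.
Proof.
move=> ap1 ap2 ap3 up; rewrite ltnNge; apply/negP => k_le; apply: noB.
have interior_rcons q x : interior (rcons q x) = q.
  by rewrite /interior size_rcons -cats1 take_size_cat.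
move: up; rewrite /= !cat_uniq !inE !(has_cat, mem_cat, negb_or).
case/and3P=> /and4P[nuv u1 u2 u3] /and3P[v1 v2 v3].
case/and4P=> uq1 /andP[/hasPn d12 /hasPn d13] uq2 /andP[/hasPn d23 uq3].
exists u, v, (rcons p1 v), (rcons p2 v), (rcons p3 u); split=> //.
- by split; [split; rewrite ?last_rcons //= mem_rcons inE negb_or nuv u1 rcons_uniq v1|
     rewrite size_rcons -addn1].
- by split; [split; rewrite ?last_rcons //= mem_rcons inE negb_or nuv u2 rcons_uniq v2|
     rewrite size_rcons].
- by split; [split; rewrite ?last_rcons //= mem_rcons inE negb_or eq_sym nuv v3 rcons_uniq u3|
     rewrite size_rcons].
rewrite /int_disjoint !interior_rcons; split=> z zp; apply/negP => zq.
- by have := d12 z zq; rewrite zp.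
- by have := d13 z zq; rewrite zp.
by have := d23 z zq; rewrite zp.
Qed.

(** The arc [s'] serves as the return path; the ear and the arc [s] can each play the long path of
    the subdivision. *)
Lemma ear_short A u v s s' q : cycle_arcs A u v s s' ->
    path a u (rcons q v) -> uniq q -> {in q, forall z, z \notin A} ->
  size q + 1 < k /\ size s + 1 < k.
Proof.
case=> au av uq Em aq uq_q qA.
have [us vs'] : u \notin q /\ v \notin q.
  by split; apply/negP => /qA; rewrite Em !(inE, mem_cat) eqxx ?orbT.
have dis z : z \in q -> (z \notin s) && (z \notin s').
  by move/qA; rewrite Em !(inE, mem_cat) !negb_or => /and4P[_ -> _ ->].
have uq1 : uniq [:: u, v & q ++ s ++ s'].
  have /perm_uniq : perm_eq (u :: s ++ v :: s') (u :: v :: s ++ s').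
    by rewrite perm_cons -cat1s perm_catCA.
  rewrite uq /= => /esym; rewrite !inE !mem_cat !negb_or => /and3P[/and3P[-> -> ->] /andP[-> ->] uqs].
  rewrite us vs' cat_uniq uq_q uqs /= andbT; apply/hasPn => z; rewrite mem_cat => zs.
  by apply/negP => /dis; case/orP: zs => ->; rewrite ?andbF.
have uq2 : uniq [:: u, v & s ++ q ++ s'].
  by rewrite -(perm_uniq (_ : perm_eq [:: u, v & q ++ s ++ s'] _)) // !perm_cons perm_catCA.
by split; [apply: noB_short aq au av uq1 | apply: noB_short au aq av uq2].
Qed.

(* A minimal dipath [q] from [x'] in [A] to [y] in [C] makes [A[u,x'] q] an ear of [C] and [q C[y,u]] an ear of [A]; hence [C[u,y]] and [C[y,u]] are both too short for the length of [C]. *)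
Lemma separation C A u x p : dicycle C -> dicycle A -> 2 * k - 2 <= #|C| ->
    u \in C -> u \in A -> (forall z, z \in C -> z \in A -> z = u) ->
  path a x p -> u \notin x :: p -> x \in A -> last x p \in C -> False.
Proof.
move=> cC cA szC uC uA CA ap up xA lC.
have [|x' [q [y [aq uq /andP[x'A yC] qAC sub]]]] := ear_extract ap xA lC.
  by move=> z zp zA; apply/negP => zC; move: up; rewrite -(CA _ zC zA) zp.
have {x'A yC} [x'A yC] : x' \in A /\ y \in C by [].
have {}qAC z : z \in q -> (z \notin A) && (z \notin C) by move/qAC.
have nux : u != x' by apply: contraNneq up => ->; rewrite sub ?mem_head.
have nuy : u != y by apply: contraNneq up => ->; rewrite sub // inE mem_rcons mem_head orbT.
have [s [s' arcsA]] := dicycle_arcs cA uA x'A nux.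
have [t [t' arcsC]] := dicycle_arcs cC uC yC nuy.
have [auA auA' uqA EA] := arcsA; have [auC auC' uqC EC] := arcsC.
have inA z : z \in s -> (z \in A) * (z != u) * (z \notin q).
  move=> zs; split; first split.
  - by rewrite EA !(inE, mem_cat) zs !orbT.
  - by apply: contraTneq zs => ->; move: uqA; rewrite /= mem_cat negb_or => /andP[/andP[]].
  by apply/negP => /qAC/andP[]; rewrite EA !(inE, mem_cat) zs !orbT.
have inC z : z \in t' -> (z \in C) * (z != u) * (z \notin q).
  move=> zs; split; first split.
  - by rewrite EC !(inE, mem_cat) zs !orbT.
  - by apply: contraTneq zs => ->; move: uqC; rewrite /= mem_cat inE !negb_or => /andP[/and3P[]].
  by apply/negP => /qAC/andP[_]; rewrite EC !(inE, mem_cat) zs !orbT.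
have uq_q : uniq q by move: uq; rewrite /= rcons_uniq => /and3P[].
have uq_s : uniq s by move: uqA; rewrite /= cat_uniq => /and3P[].
have uq_t : uniq t' by move: uqC; rewrite /= cat_uniq /= => /and5P[].
have x'C : x' \notin C by apply: contraNN nux => x'C; rewrite (CA _ x'C x'A).
have yA : y \notin A by apply: contraNN nuy => yA; rewrite (CA _ yC yA).
have x'q : x' \notin q by apply/negP => /qAC; rewrite x'A.
have yq : y \notin q by apply/negP => /qAC; rewrite yC andbF.
have [] := @ear_short C u y t t' (s ++ x' :: q) arcsC.
- rewrite rcons_cat /= cat_path /=; move: auA; rewrite rcons_path => /andP[-> ->]; exact: aq.
- have x's : x' \notin s.
    by move: uqA; rewrite /= cat_uniq /= negb_or => /and4P[_ _ /andP[] ].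
  rewrite cat_uniq uq_s /= x'q uq_q andbT negb_or x's /=.
  by rewrite andbT; apply/hasPn => z zq; apply/negP => /inA[_]; rewrite zq.
- move=> z; rewrite mem_cat inE => /or3P[/inA[[zA nzu] _]|/eqP->//|/qAC/andP[]//].
  by apply: contraNN nzu => zC; rewrite (CA _ zC zA).
move=> _ szt.
have [] := @ear_short A x' u s' s (q ++ y :: t') (cycle_arcs_sym arcsA).
- by rewrite rcons_cat /= -cat_rcons cat_path aq last_rcons.
- have yt : y \notin t' by move: uqC; rewrite /= cat_uniq /= => /and5P[].
  rewrite cat_uniq uq_q /= uq_t negb_or yq yt /= andbT.
  by apply/hasPn => z /inC[].
- move=> z; rewrite mem_cat inE => /or3P[/qAC/andP[]//|/eqP->//|/inC[[zC nzu] _]].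
  by apply: contraNN nzu => zA; rewrite (CA _ zC zA).
(* The two ears give [size t <= k - 2] and [size t' <= k - 3], hence [#|C| <= 2 * k - 3]. *)
by rewrite size_cat /=; have := cycle_arcs_size arcsC; clear -szC szt; lia.
Qed.

End Dicycles.

(** * Dicycles pairwise meeting in at most one vertex *)

Section NiceFamily.
Variables (T : finType) (a : rel T) (k : nat).
Hypothesis irr : irreflexive a.
Hypothesis noB : ~ contains_subdiv_B a k 1 1.
Implicit Types (A B C : {set T}) (D : {set {set T}}) (x y z u v w : T) (p q s c : seq T).

Definition nice D :=
  [forall A in D, dicycle a A && (2 * k - 2 <= #|A|)] &&
  [forall A in D, forall B in D, (A != B) ==> (#|A :&: B| <= 1)].

Definition linked D : rel T := fun x y => [exists A in D, (x \in A) && (y \in A)].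

Lemma linkedP D x y :
  reflect (exists A, [/\ A \in D, x \in A & y \in A]) (linked D x y).
Proof.
apply: (iffP exists_inP) => [[A AD /andP[xA yA]]|[A [AD xA yA]]]; exists A => //.
by rewrite xA.
Qed.

Lemma linked_sym D : symmetric (linked D).
Proof. by move=> x y; apply: eq_existsb => A; rewrite (andbC (x \in A)). Qed.

Lemma connect_linked_sym D : connect_sym (linked D).
Proof. exact/sym_connect_sym/linked_sym. Qed.

Lemma sub_linked D D' : D' \subset D -> subrel (linked D') (linked D).
Proof.
by move=> sub x y /linkedP[A [AD xA yA]]; apply/linkedP; exists A; rewrite (subsetP sub).
Qed.

Variable CC : {set {set T}}.
Hypothesis niceCC : nice CC.

Lemma nice_dicycle A : A \in CC -> dicycle a A /\ 2 * k - 2 <= #|A|.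
Proof. by case/andP: niceCC => /forall_inP H _ /H/andP. Qed.

Lemma nice_meet A B x y : A \in CC -> B \in CC -> x \in A -> x \in B ->
  y \in A -> y \in B -> x != y -> A = B.
Proof.
move=> AC BC xA xB yA yB nxy; apply/eqP; apply: contraT => nAB.
case/andP: niceCC => _ /forall_inP/(_ _ AC)/forall_inP/(_ _ BC); rewrite nAB /=.
rewrite leqNgt; case/negP; rewrite (cardD1 x) (cardD1 y) !inE.
by rewrite xA xB yA yB eq_sym nxy.
Qed.

Definition reaches C u z := exists2 p, path a z p & u \notin z :: p /\ last z p \in C.

Lemma reaches_mem C B u z : C \in CC -> B \in CC -> u \in C -> u \in B -> z \in B ->
  reaches C u z -> B = C.
Proof.
move=> CC_ BC uC uB zB [p ap [up lp]]; apply/eqP; apply: contraT => nBC.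
have [cC szC] := nice_dicycle CC_; have [cB szB] := nice_dicycle BC.
case: (@separation _ a k noB C B u z p cC cB szC uC uB _ ap up zB lp) => x xC xB.
apply/eqP; apply: contraT => nxu; case/negP: nBC; apply/eqP.
exact: (@nice_meet _ _ x u).
Qed.

(** If the member through [w] and [z] contains [u], it is [C] itself by [reaches_mem]. Otherwise one
    can follow it from [w] to [z] without meeting [u]. *)
Lemma reaches_linked C u z w : C \in CC -> u \in C -> w != u -> linked CC w z ->
  reaches C u z -> reaches C u w.
Proof.
move=> CC_ uC nwu /linkedP[A [AC wA zA]] rz.
have [uA|uA] := boolP (u \in A).
  have EA := reaches_mem CC_ AC uC uA zA rz.
  by exists [::] => //; rewrite inE eq_sym nwu -EA.
have [->//|nwz] := eqVneq w z.
have [cA _] := nice_dicycle AC; have [s [s' [aw _ _ EA]]] := dicycle_arcs cA wA zA nwz.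
case: rz => p ap [up lp]; exists (rcons s z ++ p).
  by rewrite cat_path aw last_rcons.
rewrite last_cat last_rcons; split=> //.
rewrite -cat_cons mem_cat negb_or; move: up; rewrite inE negb_or => /andP[_ ->].
rewrite andbT; apply: contra uA; rewrite EA !(inE, mem_rcons, mem_cat).
by case/or3P=> ->; rewrite ?orbT.
Qed.

Lemma reaches_path C u z p : C \in CC -> u \in C -> path (linked CC) z p ->
  u \notin z :: p -> reaches C u (last z p) -> reaches C u z.
Proof.
move=> CC_ uC; elim: p z => [|y p IHp] z //= /andP[lzy lp] up rl.
move: up; rewrite inE negb_or => /andP[nuz up].
by apply: (reaches_linked CC_ uC _ lzy (IHp _ lp up rl)); rewrite eq_sym.
Qed.

(** The arc from [x] to [v] lets [x], and then [w2] by going back along the links, reach the member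
    [A] of the first link while avoiding [w1]. So the second link lies in [A] as well, and [w1] can
    be skipped. *)
Lemma arc_linked x v p : a x v -> path (linked CC) v p -> last v p = x ->
  uniq (v :: p) -> linked CC v x.
Proof.
move=> axv; elim/ltn_ind: {p}(size p) {-2}p (erefl (size p)) => n IHn.
case=> [|w1 [|w2 p]] sz_p /=; first by move=> _ Ev; rewrite Ev irr in axv.
  by rewrite andbT => lvw <-.
case/and3P=> lvw1 lw12 lp Ex /and4P[].
rewrite !inE !negb_or => /and3P[nv1 nv2 vp] /andP[n12 w1p] w2p up.
have /linkedP[A [AC vA w1A]] := lvw1; have /linkedP[B [BC w1B w2B]] := lw12.
have n1x : w1 != x.
  have : x \in w2 :: p by rewrite -Ex mem_last.
  by apply: contraTneq => <-; rewrite inE negb_or n12.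
have rx : reaches A w1 x.
  exists [:: v]; first by rewrite /= axv.
  by rewrite !inE !negb_or n1x eq_sym nv1 vA.
have rw2 : reaches A w1 w2.
  by apply: (reaches_path AC w1A lp); rewrite ?Ex // inE negb_or n12.
have EB := reaches_mem AC BC w1A w1B w2B rw2.
have lvw2 : linked CC v w2 by apply/linkedP; exists A; rewrite -{3}EB.
apply: (IHn (size (w2 :: p)) _ (w2 :: p)) => //=; first by rewrite -sz_p.
  by rewrite lvw2.
by rewrite inE negb_or nv2 vp w2p.
Qed.

Lemma connect_linked_arc x v : a x v -> connect (linked CC) x v -> linked CC x v.
Proof.
rewrite connect_linked_sym linked_sym => axv /connectP[p0 lp0 Ex].
by case/shortenP: lp0 Ex => p lp up _ Ex; apply: arc_linked axv lp _ up.
Qed.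

(** Otherwise the second vertex of a chain of links from [u] to [v] reaches [C] while avoiding [u],
    so the first link, a member of [D], would be [C]. *)
Lemma nice_acyclic D C u v : D \subset CC -> C \in CC -> C \notin D ->
  u \in C -> v \in C -> connect (linked D) u v -> u = v.
Proof.
move=> sub CC_ CD uC vC /connectP[p0 lp0 Ev].
case/shortenP: lp0 Ev => -[|w p] //= /andP[luw lp] /andP[up _] _ Ev.
have {}lp := sub_path (sub_linked sub) lp.
have nuv : u != v by apply: contraNneq up => ->; rewrite Ev mem_last.
have rv : reaches C u v by exists [::] => //; rewrite inE.
have rw : reaches C u w by apply: (reaches_path CC_ uC lp) => //; rewrite -Ev.
case/linkedP: luw => B [BD uB wB].
by rewrite -(reaches_mem CC_ (subsetP sub _ BD) uC uB wB rw) BD in CD.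
Qed.

(** Induction on the size of [D], adding one member [A]. Each component of the rest meets [A] in at
    most one vertex [u], so transposing two colours on that component makes it agree with the
    colouring [g] of [A] at [u]. *)
Lemma glue_colorings (N : finType) D : D \subset CC ->
    (forall A, A \in CC -> exists f : T -> N,
       {in A &, forall x y, und_adj a x y -> f x != f y}) -> N ->
  exists f : T -> N, {in D, forall A, {in A &, forall x y, und_adj a x y -> f x != f y}}.
Proof.
move=> sub memb n0; elim/ltn_ind: {D}#|D| {-2}D (erefl #|D|) sub => n IHn D szD sub.
have [->|[A AD]] := set_0Vmem D; first by exists (fun=> n0) => A; rewrite inE.
have AC := subsetP sub _ AD; have [g gP] := memb A AC.
set D' := D :\ A; have sub' : D' \subset CC by apply: subset_trans sub; exact: subD1set.
have AD' : A \notin D' by rewrite !inE eqxx.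
have [|f fP] := IHn #|D'| _ D' erefl sub'; first by rewrite -szD (cardsD1 A D) AD.
pose h x := if [pick u in A | connect (linked D') x u] is Some u
            then tperm (f u) (g u) (f x) else f x.
have hA x : x \in A -> h x = g x.
  rewrite /h => xA; case: pickP => [u /andP[uA xu]|/(_ x)]; last by rewrite xA connect0.
  by rewrite -(nice_acyclic sub' AC AD' xA uA xu) tpermL.
exists h => B BD x y xB yB adj.
have [EB|nBA] := eqVneq B A; first by rewrite !hA -?EB // gP // -EB.
have BD' : B \in D' by rewrite !inE nBA.
have lxy : connect (linked D') x =1 connect (linked D') y.
  apply: (same_connect (connect_linked_sym D')); apply: connect1.
  by apply/linkedP; exists B.
rewrite /h (eq_pick (Q := fun u => (u \in A) && connect (linked D') y u)); last first.
  by move=> u; rewrite /= lxy.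
have := fP B BD' x y xB yB adj.
by case: pickP => // u _; rewrite (inj_eq perm_inj).
Qed.
End NiceFamily.

(** * Colouring a single long dicycle *)

(* Cut the cyclic order into blocks of length between [m + 1] and [2 m] and colour each position by its offset in its block; [2 m + 1] is the only length that admits no such cutting. *)
Lemma cycle_power_coloring m n : 2 <= m -> m < n -> n != 2 * m + 1 ->
  exists f : nat -> nat, [/\ forall i, i <= m -> f i = i,
    forall i, i < n -> f i < 2 * m &
    forall i j, i < j < n -> (j - i <= m) || (i + n - j <= m) -> f i != f j].
Proof.
move=> m_ge2; elim/ltn_ind: n => n IHn lt_mn n_neq.
have [n_le|n_gt] := leqP n (2 * m).
  by exists id; split=> //; lia.
(* A first block of length [m + 1] would leave the forbidden length [2 * m + 1] exactly when
   [n = 3 * m + 2]. *)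
pose s := if n == 3 * m + 2 then m + 2 else m.+1.
have s_bd : m < s <= 2 * m by rewrite /s; case: ifP; lia.
have n_bd : (m < n - s) && (n - s != 2 * m + 1) by rewrite /s; case: ifP; lia.
have [||f [f_id f_lt f_neq]] := IHn (n - s) _ _ (andP n_bd).2; try lia.
exists (fun i => if i < s then i else f (i - s)); split=> [i le_im|i lt_in|i j ij].
- by case: ifP; lia.
- by case: ifP => lt_is; [lia | apply: f_lt; lia].
case: (ltnP i s) => lt_is; case: (ltnP j s) => lt_js; first by lia.
(* Across the end of the first block, [f] is the identity at [j - s]. Across the wrap-around, [i]
   has the colour of position [i] in the shorter cycle, where the distance is unchanged. *)
- case/orP=> near; first by rewrite f_id; lia.
  by rewrite -{1}(f_id i) ?f_neq //; lia.
- by lia.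
by move=> near; apply: f_neq; lia.
Qed.

Section LongDicycle.
Variables (T : finType) (a : rel T) (k : nat).
Hypotheses (k_ge3 : 3 <= k) (irr : irreflexive a).
Hypothesis noB : ~ contains_subdiv_B a k 1 1.
Implicit Types (A B C : {set T}) (x y z u v w : T) (p q s c : seq T).

Lemma ucycle_arcs s1 x s2 y s3 : ucycle a (s1 ++ x :: s2 ++ y :: s3) ->
  cycle_arcs a [set z in s1 ++ x :: s2 ++ y :: s3] x y s2 (s3 ++ s1).
Proof.
have perm_c : perm_eq (s1 ++ x :: s2 ++ y :: s3) (x :: s2 ++ y :: s3 ++ s1).
  by rewrite perm_catC /= -catA.
case/andP=> cc uc; split=> [||| z].
- rewrite rcons_path; move: cc; rewrite -(rot_cycle (size s1)) rot_size_cat /= !rcons_cat cat_path /=.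
  by rewrite cat_path => /andP[/andP[-> /andP[->]]].
- rewrite rcons_cat cat_path.
  move: cc; rewrite -(rot_cycle (size s1)) rot_size_cat /= !rcons_cat cat_path cat_path last_cat /=.
  by case/andP=> /and3P[_ _ ->].
- by rewrite -(perm_uniq perm_c).
by rewrite inE (perm_mem perm_c).
Qed.

Lemma uniq_split2 c x y : x \in c -> y \in c -> x != y ->
  exists s1 s2 s3, c = s1 ++ x :: s2 ++ y :: s3 \/ c = s1 ++ y :: s2 ++ x :: s3.
Proof.
case/splitPr=> p1 p2; rewrite mem_cat inE => /or3P[|/eqP->|] xy; last 2 first.
- by rewrite eqxx in xy.
- by case/splitPr: xy => q1 q2 _; exists p1, q1, q2; left.
by case/splitPr: xy => q1 q2 _; exists q1, q2, p2; right; rewrite -catA.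
Qed.

Lemma chord_short C x y s s' : cycle_arcs a C x y s s' -> a x y -> size s + 1 < k.
Proof.
move=> arcs axy; have [] := @ear_short T a k noB C x y s s' [::] arcs; rewrite /= ?axy //.
Qed.

(** An arc from [y] to [x] would bound the other side by [chord_short], and both sides together
    would be too short. *)
Lemma chord_forward C x y s s' : cycle_arcs a C x y s s' -> #|C| = 2 * k - 1 ->
  und_adj a x y -> size s < k - 1 -> a x y.
Proof.
move=> arcs szC /andP[_ /orP[//|ayx]] sz_s.
have := chord_short (cycle_arcs_sym arcs) ayx; have := cycle_arcs_size arcs.
clear -szC sz_s k_ge3; lia.
Qed.

(* If [c] were complete, all forward chords of length at most [k - 1] would be arcs, and then
   [x0 h .. l h' .. l' x1], [x0 x1] and [x1 z x0] form a subdivision of B(k,1;1), where [c] is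
   [x0 x1 h .. l z h' .. l'] and [z] is opposite to [x0 x1]. *)
Lemma nonadjacent_pair c : ucycle a c -> size c = 2 * k - 1 ->
  exists x y, [/\ x \in c, y \in c, x != y & ~~ und_adj a x y].
Proof.
move=> ucc szc; apply: NNPP => no_pair.
have uqc : uniq c by case/andP: ucc.
have adj x y : x \in c -> y \in c -> x != y -> und_adj a x y.
  by move=> xc yc nxy; apply: contraT => nadj; case: no_pair; exists x, y.
have card_c : #|[set z in c]| = 2 * k - 1 by rewrite cardsE (card_uniqP uqc).
have fwd s1 x s2 y s3 : c = s1 ++ x :: s2 ++ y :: s3 ->
    (size s2 < k - 1 -> a x y) /\ (size (s3 ++ s1) < k - 1 -> a y x).
  move=> Ec; have arcs : cycle_arcs a [set z in c] x y s2 (s3 ++ s1).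
    by rewrite Ec; apply: ucycle_arcs; rewrite -Ec.
  have nxy : x != y.
    by move: uqc; rewrite Ec cat_uniq /= mem_cat inE !negb_or => /and4P[_ _ /and3P[]].
  have [xc yc] : x \in c /\ y \in c by rewrite Ec !(mem_cat, inE) !eqxx !orbT.
  split; first exact: (chord_forward arcs card_c (adj _ _ xc yc nxy)).
  apply: (chord_forward (cycle_arcs_sym arcs) card_c); apply: adj; by rewrite // eq_sym.
have [x0 [x1 [h [t [z [h' [t' [Ec szt szt']]]]]]]] : exists x0 x1 h t z h' t',
    [/\ c = [:: x0, x1, h & t ++ z :: h' :: t'], size t = k - 3 & size t' = k - 3].
  case: (c) szc => [|x0 [|x1 [|h c']]] /=; try by clear -k_ge3; lia.
  move=> szc; case Ed: (drop (k - 3) c') => [|z [|h' t']];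
    have := size_drop (k - 3) c'; rewrite Ed /=; try by clear -k_ge3 szc; lia.
  move=> szt'; exists x0, x1, h, (take (k - 3) c'), z, h', t'.
  rewrite -Ed cat_take_drop size_takel; last by clear -k_ge3 szc; lia.
  by split=> //; clear -k_ge3 szc szt'; lia.
pose l := last h t; pose l' := last h' t'.
have Eht : h :: t = rcons (belast h t) l by rewrite -lastI.
have Eht' : h' :: t' = rcons (belast h' t') l' by rewrite -lastI.
have cc : cycle a c by case/andP: ucc.
have [at_ at'] : path a h t /\ path a h' t'.
  move: cc; rewrite Ec /= rcons_cat cat_path /= rcons_path.
  by case/and5P=> _ _ -> _ /and3P[_ -> _].
have a01 : a x0 x1 by move: cc; rewrite Ec /= => /andP[].
have a0h : a x0 h.
  by apply: (fwd [::] x0 [:: x1] h (t ++ z :: h' :: t') Ec).1 => /=; clear -k_ge3; lia.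
have alh' : a l h'.
  apply: (fwd (x0 :: x1 :: belast h t) l [:: z] h' t' _).1 => /=; last by clear -k_ge3; lia.
  by rewrite Ec -[h :: t ++ _]/((h :: t) ++ _) Eht cat_rcons.
have al'x1 : a l' x1.
  apply: (fwd [:: x0] x1 (h :: t ++ z :: belast h' t') l' [::] _).2 => /=; last by clear -k_ge3; lia.
  by rewrite Ec Eht' -cats1 /= -catA.
have a1z : a x1 z.
  by apply: (fwd [:: x0] x1 (h :: t) z (h' :: t') Ec).1 => /=; clear -k_ge3 szt; lia.
have az0 : a z x0.
  apply: (fwd [::] x0 (x1 :: h :: t) z (h' :: t') Ec).2; rewrite cats0 /=; clear -k_ge3 szt'; lia.
(* The long path has [2 * k - 4] interior vertices, so its length [2 * k - 3] is at least [k]. *)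
have := @noB_short T a k noB x0 x1 (h :: t ++ h' :: t') [::] [:: z].
rewrite /= a01 a1z az0 a0h rcons_cat cat_path at_ /= alh' rcons_path at' al'x1 /= size_cat /=.
move=> /(_ isT isT isT); rewrite (_ : _ && _ = true); last first.
  rewrite -[RHS]uqc Ec -[LHS]/(uniq [:: x0, x1, h & (t ++ h' :: t') ++ [:: z]]).
  by apply: perm_uniq; rewrite !perm_cons -catA perm_cat2l perm_catC.
move=> /(_ isT); clear -k_ge3 szt szt'; lia.
Qed.

(** Chords join positions at cyclic distance at most [k - 1], so [cycle_power_coloring] with
    [m = k - 1] applies except at length [2 * k - 1]. There, two nonadjacent vertices share a colour
    and all others get their own. *)
Lemma long_dicycle_coloring C : dicycle a C -> 2 * k - 2 <= #|C| ->
  exists f : T -> 'I_(2 * k - 2),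
    {in C &, forall x y, und_adj a x y -> f x != f y}.
Proof.
case/dicycleP=> c ucc ->; rewrite cardsE; have [cc uqc] := andP ucc.
rewrite (card_uniqP uqc) => szc.
have N_gt0 : 0 < 2 * k - 2 by lia.
suff [f [f_lt f_neq]] : exists f : T -> nat,
    {in c, forall x, f x < 2 * k - 2} /\ {in c &, forall x y, a x y -> f x != f y}.
  (* The default colour is taken only outside [c]. *)
  exists (fun x => insubd (Ordinal N_gt0) (f x)) => x y; rewrite !inE => xc yc adj.
  rewrite -val_eqE !val_insubd !f_lt //; case/andP: adj => _ /orP[]; first exact: f_neq.
  by rewrite eq_sym; exact: f_neq.
have [szc_eq|szc_neq] := eqVneq (size c) (2 * k - 1).
  have [u [v [uc vc nuv nadj]]] := nonadjacent_pair ucc szc_eq.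
  pose c' := rem v c; have memc' x : (x \in c') = (x != v) && (x \in c) by rewrite mem_rem_uniq.
  have szc' : size c' = 2 * k - 2 by rewrite size_rem // szc_eq; clear -k_ge3; lia.
  pose r x := if x == v then u else x.
  have rc' x : x \in c -> r x \in c'.
    by move=> xc; rewrite /r memc'; case: (eqVneq x v) => [_|->]; rewrite ?nuv.
  exists (fun x => index (r x) c'); split=> [x xc|x y xc yc axy].
    by rewrite -szc' index_mem rc'.
  apply: contraTneq axy => /(congr1 (nth u c')); rewrite !nth_index ?rc' // /r.
  case: eqP => [->|_]; case: eqP => [->|_]; rewrite ?irr // => E.
  - by apply: contra nadj => avu; rewrite /und_adj nuv E avu orbT.
  - by apply: contra nadj => avu; rewrite /und_adj nuv -E avu.
  by rewrite E irr.
have [|||f [_ f_lt f_neq]] := @cycle_power_coloring (k - 1) (size c).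
- by clear -k_ge3; lia.
- by apply: leq_trans szc; clear -k_ge3; lia.
- by apply: contraNneq szc_neq => ->; apply/eqP; clear -k_ge3; lia.
exists (fun x => f (index x c)); split=> [x xc|x y xc yc axy].
  by have := f_lt (index x c); rewrite index_mem => /(_ xc); clear -k_ge3; lia.
have nxy : x != y by apply: contraTneq axy => ->; rewrite irr.
have index_split s1 u s2 v s3 : uniq (s1 ++ u :: s2 ++ v :: s3) ->
   index u (s1 ++ u :: s2 ++ v :: s3) = size s1 /\
   index v (s1 ++ u :: s2 ++ v :: s3) = size s1 + (size s2).+1.
  have index_mid r w r' : uniq (r ++ w :: r') -> index w (r ++ w :: r') = size r.
    rewrite index_cat cat_uniq /= negb_or eqxx addn0 => /and3P[_ /andP[]].
    by case: (w \in r).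
  move=> uq; split; first exact: index_mid.
  by move: uq; rewrite -cat_cons catA => /index_mid; rewrite size_cat.
have [s1 [s2 [s3 [Ec|Ec]]]] := uniq_split2 xc yc nxy; rewrite Ec in uqc ucc szc szc_neq f_neq *;
  have [-> ->] := index_split _ _ _ _ _ uqc; have arcs := ucycle_arcs ucc;
  move: szc szc_neq f_neq; rewrite size_cat /= size_cat /= => szc szc_neq f_neq.
  have := chord_short arcs axy => sz2; apply: f_neq; clear -k_ge3 sz2; lia.
have := chord_short (cycle_arcs_sym arcs) axy; rewrite size_cat => sz2.
rewrite eq_sym; apply: f_neq; clear -k_ge3 sz2; lia.
Qed.

End LongDicycle.

(** * Contraction *)

Lemma split_first (T : Type) (P : pred T) s : has P s ->
  exists s1 x s2, [/\ s = s1 ++ x :: s2, P x & ~~ has P s1].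
Proof.
elim: s => //= y s IHs; case: (boolP (P y)) => [Py _|nPy /= /IHs].
  by exists [::], y, s.
by case=> s1 [x [s2 [-> Px nP]]]; exists (y :: s1), x, s2; rewrite /= negb_or nPy.
Qed.

Lemma split_last (T : Type) (P : pred T) s : has P s ->
  exists s1 x s2, [/\ s = s1 ++ x :: s2, P x & ~~ has P s2].
Proof.
rewrite -has_rev => /split_first[s1 [x [s2 [Es Px nP]]]].
exists (rev s2), x, (rev s1); rewrite has_rev -cat_rcons -rev_cons -rev_cat -Es revK.
by split.
Qed.

Section Contraction.
Variables (T T' : finType) (a : rel T) (h : T -> T').
Implicit Types (x y z : T) (r : T') (q s c : seq T) (p : seq T').

Definition contract : rel T' := fun r r' =>
  (r != r') && [exists x, exists y, [&& a x y, h x == r & h y == r']].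

Lemma contract_arc x y : a x y -> h x != h y -> contract (h x) (h y).
Proof.
move=> axy nh; rewrite /contract nh; apply/existsP; exists x; apply/existsP; exists y.
by rewrite axy !eqxx.
Qed.

Lemma contract_strong : (forall r, exists x, h x = r) ->
  strongly_connected a -> strongly_connected contract.
Proof.
move=> h_surj strong r r'; have [x <-] := h_surj r; have [y <-] := h_surj r'.
case/connectP: (strong x y) => q aq ->; elim: q x aq => [|z q IHq] x /=.
  by rewrite connect0.
case/andP=> axz /IHq; have [->//|nh] := eqVneq (h x) (h z).
exact/connect_trans/connect1/contract_arc.
Qed.

Hypothesis h_conn : forall x y, h x = h y ->
  exists q, [/\ path a x q, last x q = y & {in q, forall z, h z = h x}].

(** Each vertex of [p] is replaced by a simple dipath inside its class. The last clause says that
    every class occupies one contiguous block, which allows rotating a lifted dicycle to any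
    class. *)
Lemma lift_path p r x y : path contract r p -> uniq (r :: p) ->
    h x = r -> h y = last r p ->
  exists q, [/\ path a x q, last x q = y, uniq (x :: q),
      r :: p =i map h (x :: q) &
      forall r0, exists s0 s1 s2, [/\ x :: q = s0 ++ s1 ++ s2,
        {in s0 ++ s2, forall z, h z != r0} & {in s1, forall z, h z = r0}]].
Proof.
have one_class x1 y1 : h x1 = h y1 -> exists q,
    [/\ path a x1 q, last x1 q = y1, uniq (x1 :: q) & {in x1 :: q, forall z, h z = h x1}].
  move=> E; have [q0 [aq0 Ey hq]] := h_conn E; case/shortenP: aq0 Ey => q aq uq sub Ey.
  by exists q; split=> // z; rewrite inE => /predU1P[->//|/sub/hq].
elim: p r x => [|r1 p IHp] r x /=.
  move=> _ _ hx hy; have [|q [aq Ey uq hq]] := @one_class x y; first by rewrite hx hy.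
  rewrite -hx; exists q; split=> // [r0|r0].
    rewrite !inE; apply/idP/idP => [->//|/predU1P[->//|/mapP[z zq ->]]].
    by rewrite hq // inE zq orbT.
  have [E|nE] := eqVneq (h x) r0.
    by exists [::], (x :: q), [::]; split; rewrite ?cats0 //= => z /hq; rewrite E.
  by exists (x :: q), [::], [::]; split; rewrite ?cats0 // => z /hq->.
case/andP=> /andP[nr1 /existsP[x1 /existsP[y1 /and3P[a1 /eqP hx1 /eqP hy1]]]] cp.
case/andP=> rp up hx hy.
have [q' [aq' Ey uq' Eq' cont]] := IHp r1 y1 cp up hy1 hy.
have [|q [aq Ex1 uq hq]] := @one_class x x1; first by rewrite hx.
have hq' z : z \in y1 :: q' -> h z \in r1 :: p by rewrite Eq' => /(map_f h).
have hq'r z : z \in y1 :: q' -> h z != r.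
  by move/hq' => hz; apply: contraNneq rp => <-.
exists (q ++ y1 :: q'); split.
- by rewrite cat_path aq /= Ex1 a1.
- by rewrite last_cat.
- rewrite -[_ && _]/(uniq ((x :: q) ++ y1 :: q')) cat_uniq uq uq' andbT; apply/hasPn => z /hq'r.
  by apply: contra => /hq->; rewrite hx.
- move=> r0; rewrite -[h x :: _]/(map h ((x :: q) ++ y1 :: q')) map_cat mem_cat inE Eq'; congr (_ || _).
  apply/idP/idP => [/eqP->|/mapP[z /hq-> ->]]; last by rewrite hx.
  by rewrite -hx map_f ?mem_head.
move=> r0; have [E|nE] := eqVneq r r0.
  exists [::], (x :: q), (y1 :: q'); split=> //= z; first by rewrite -E => /hq'r.
  by move/hq; rewrite hx E.
have [s0 [s1 [s2 [Es h02 h1]]]] := cont r0.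
exists ((x :: q) ++ s0), s1, s2; split=> //; first by rewrite -catA -Es.
by move=> z; rewrite -catA mem_cat => /orP[/hq->|/h02//]; rewrite hx.
Qed.

(** A single lift [c] serves all classes: for each [r] it is rotated so that the block [s1] of [r]
    comes first, and [s2] then meets every other class of [p]. *)
Lemma lift_dicycle p : ucycle contract p -> p != [::] -> exists c,
  c != [::] /\ forall r, r \in map h c -> exists s1 s2,
    [/\ ucycle a (s1 ++ s2), c =i s1 ++ s2, {in s1, forall z, h z = r},
        {in s2, forall z, h z != r} & size p <= (size s2).+1].
Proof.
case: p => // r p /andP[/= cp up] _.
move: cp; rewrite rcons_path => /andP[cp].
case/andP=> _ /existsP[x1 /existsP[y1 /and3P[a1 /eqP hx1 /eqP hy1]]].
have [q [aq Ex1 uq Eq cont]] := lift_path cp up hy1 hx1.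
exists (y1 :: q); split=> // r0 r0q; have [s0 [s1 [s2 [Es h02 h1]]]] := cont r0.
have perm_c : perm_eq (y1 :: q) (s1 ++ s2 ++ s0) by rewrite Es perm_catC catA.
exists s1, (s2 ++ s0); split=> //.
- rewrite /ucycle -(perm_uniq perm_c) uq andbT catA -rot_size_cat rot_cycle -Es /=.
  by rewrite rcons_path aq Ex1.
- exact: perm_mem perm_c.
- by move=> z zs; apply: h02; rewrite mem_cat orbC -mem_cat.
rewrite -Eq in r0q.
suff: size (rem r0 (r :: p)) <= size (s2 ++ s0) by rewrite size_rem.
rewrite -(size_map h (s2 ++ s0)); apply: uniq_leq_size; first exact: rem_uniq.
move=> r1; rewrite mem_rem_uniq // inE Eq => /andP[nr10 /mapP[z zq Er1]].
rewrite Er1; move: zq; rewrite (perm_mem perm_c) mem_cat => /orP[/h1 hz|/(map_f h)//].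
by rewrite Er1 hz eqxx in nr10.
Qed.

End Contraction.

(** * Contracting the components of a maximal family, and the product colouring *)

Section Main.
Variables (T : finType) (a : rel T) (k : nat).
Hypotheses (k_ge3 : 3 <= k) (irr : irreflexive a) (strong : strongly_connected a).
Hypothesis noB : ~ contains_subdiv_B a k 1 1.
Implicit Types (A B C : {set T}) (x y z u v w : T) (p q s c : seq T).

Variable CC : {set {set T}}.
Hypothesis niceCC : nice a k CC.
Hypothesis maxCC : forall D, nice a k D -> #|D| <= #|CC|.

Local Notation lk := (linked CC).
Local Notation comp_type := {x : T | root (linked CC) x == x} (only parsing).

Lemma root_idem x : root lk (root lk x) == root lk x.
Proof. by rewrite root_root //; exact: connect_linked_sym. Qed.

(** The quotient map onto the components, each represented by its root. *)
Definition comp x : comp_type := exist _ (root (linked CC) x) (root_idem x).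

Lemma comp_eq x y : (comp x == comp y) = connect lk x y.
Proof. by rewrite -val_eqE /= root_connect //; exact: connect_linked_sym. Qed.

Lemma comp_surj r : exists x, comp x = r.
Proof. by exists (val r); apply: val_inj => /=; apply/eqP; exact: (valP r). Qed.

Lemma comp_member A x y : A \in CC -> x \in A -> y \in A -> comp x = comp y.
Proof.
move=> AC xA yA; apply/eqP; rewrite comp_eq; apply: connect1.
by apply/linkedP; exists A.
Qed.

Lemma comp_conn x y : comp x = comp y ->
  exists q, [/\ path a x q, last x q = y & {in q, forall z, comp z = comp x}].
Proof.
move/eqP; rewrite comp_eq => /connectP[p lp ->].
elim: p x lp => [|w p IHp] x /=; first by exists [::].
case/andP=> /linkedP[A [AC xA wA]] /IHp[q [aq Eq hq]].
have hw := comp_member AC wA xA.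
have [->|nxw] := eqVneq x w; first by exists q.
have [cA _] := nice_dicycle niceCC AC.
have [s [s' [ax _ _ EA]]] := dicycle_arcs cA xA wA nxw.
exists (rcons s w ++ q); rewrite cat_path last_cat last_rcons ax; split=> // z.
rewrite mem_cat => /orP[zs|/hq->//]; apply: comp_member AC _ xA.
by rewrite EA; move: zs; rewrite mem_rcons !(inE, mem_cat) => /orP[]->; rewrite ?orbT.
Qed.

(** The lift [Cs] of a longer dicycle meets two components, so it is not a member. It meets each
    member at most once, so adding it would contradict maximality. *)
Lemma contract_short (p : seq comp_type) : ucycle (contract a comp) p -> size p <= 2 * k - 3.
Proof.
move=> ucp; rewrite leqNgt; apply/negP => szp.
have [|c [c_neq0 cP]] := lift_dicycle comp_conn ucp; first by case: (p) szp.
have [z0 z0c] : exists z0, z0 \in c by case: c c_neq0 {cP} => // z0 c; exists z0; rewrite mem_head.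
have [s1 [s2 [ucs Ec hs1 hs2 /(leq_trans szp) szs2]]] := cP _ (map_f comp z0c).
pose Cs := [set z in c].
have ECs : Cs = [set z in s1 ++ s2] by apply/setP => z; rewrite !inE Ec.
have s2_neq0 : exists z2, z2 \in s2.
  case: (s2) szs2 => [|z2 s' _]; last by exists z2; rewrite mem_head.
  by move=> /=; clear -k_ge3; lia.
have z0s1 : z0 \in s1.
  by move: z0c; rewrite Ec mem_cat => /orP[//|/hs2]; rewrite eqxx.
have CsCC : Cs \notin CC.
  apply/negP => CsCC; have [z2 z2s] := s2_neq0; have := hs2 _ z2s.
  by rewrite (@comp_member Cs z2 z0) ?eqxx // inE // Ec mem_cat z2s orbT.
suff nU : nice a k (Cs |: CC) by have := maxCC nU; rewrite cardsU1 CsCC add1n ltnn.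
have meet A : A \in CC -> #|A :&: Cs| <= 1.
  move=> AC; rewrite leqNgt; apply/negP => /card_gt1P[u [v []]].
  rewrite !inE => /andP[uA uc] /andP[vA vc] nuv.
  have [t1 [t2 [uct Et ht1 ht2 /(leq_trans szp) szt]]] := cP _ (map_f comp uc).
  have inA_t1 z : z \in c -> z \in A -> z \in t1.
    rewrite Et mem_cat => /orP[//|/ht2 hz] zA.
    by rewrite (comp_member AC zA uA) eqxx in hz.
  (* [f] and [l] are the first and last vertices of [A] in the block of its component. Leaving this
     block at [l] and returning to [f], the lifted dicycle is an ear of [A]. *)
  have /split_first[al [f [t' [Et1 fA al_A]]]] : has (mem A) t1.
    by apply/hasP; exists u => //; exact: inA_t1.
  have /split_last[be [l [ga [Et' lA ga_A]]]] : has (mem A) t'.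
    have in_t' z : z \in c -> z \in A -> z != f -> z \in t'.
      move=> zc zA nzf; have := inA_t1 z zc zA; rewrite Et1 mem_cat inE (negPf nzf) /=.
      by case/orP=> // zal; case/negP: al_A; apply/hasP; exists z.
    have [Euf|nuf] := eqVneq u f; apply/hasP; last by exists u => //; exact: in_t'.
    by exists v => //; apply: in_t'; rewrite // -Euf eq_sym.
  rewrite Et1 Et' -!catA /= -catA /= in uct.
  have [_ al_ uq _] := ucycle_arcs uct.
  have nlf : l != f.
    by move: uq; rewrite /= mem_cat inE negb_or eq_sym => /andP[/andP[_ /norP[]]].
  have [cA _] := nice_dicycle niceCC AC.
  have [s [s' arcs]] := dicycle_arcs cA lA fA nlf.
  have [] := @ear_short T a k noB A l f s s' ((ga ++ t2) ++ al) arcs al_.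
  - by move: uq; rewrite /= cat_uniq /= => /and5P[].
  - move=> z; rewrite !mem_cat -orbA => /or3P[zg|/ht2 hz|za]; apply/negP => zA.
    + by case/negP: ga_A; apply/hasP; exists z.
    + by rewrite (comp_member AC zA uA) eqxx in hz.
    by case/negP: al_A; apply/hasP; exists z.
  (* The ear contains [t2], which has at least [2 * k - 3] vertices. *)
  by rewrite !size_cat; clear -szt k_ge3; lia.
have [/forall_inP nice1 /forall_inP nice2] := andP niceCC.
apply/andP; split; apply/forall_inP => A /setU1P[->|AC].
- rewrite (_ : dicycle a Cs); last by apply/dicycleP; exists (s1 ++ s2).
  have [_ uqs] := andP ucs; rewrite ECs cardsE (card_uniqP uqs) size_cat.
  (* [s2] has at least [2 * k - 3] vertices, and [s1] supplies the missing one. *)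
  have : 0 < size s1 by case: (s1) z0s1.
  by clear -szs2; lia.
- exact: nice1.
- apply/forall_inP => B /setU1P[->|BC]; first by rewrite eqxx.
  by apply/implyP => _; rewrite setIC meet.
apply/forall_inP => B /setU1P[->|BC]; first by rewrite meet ?implybT.
by have /forall_inP := nice2 A AC; exact.
Qed.

Lemma nice_family_colorable : colorable a ((2 * k - 2) * (2 * k - 3)).
Proof.
have N_gt0 : 0 < 2 * k - 2 by lia.
have [|f fP] := @glue_colorings T a k noB CC niceCC 'I_(2 * k - 2) CC (subxx CC) _ (Ordinal N_gt0).
  by move=> A AC; have [] := nice_dicycle niceCC AC; exact: long_dicycle_coloring.
have l_gt0 : 0 < 2 * k - 3 by lia.
have irr' : irreflexive (contract a comp) by move=> r; rewrite /contract eqxx.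
have [g gP] := coloring_of_short_dicycles irr' (contract_strong comp_surj strong) l_gt0
  contract_short.
have card_col : #|{: 'I_(2 * k - 2) * 'I_(2 * k - 3)}| = (2 * k - 2) * (2 * k - 3).
  by rewrite card_prod !card_ord.
pose col x := cast_ord card_col (enum_rank (f x, g (comp x))).
have colP x y : a x y -> col x != col y.
  move=> axy; apply: contraTneq axy => /cast_ord_inj/enum_rank_inj [Ef Eg].
  apply/negP => axy.
  (* An arc between components is separated by [g]; an arc inside one lies in a single member and is
     separated by [f]. *)
  have [E|nE] := eqVneq (comp x) (comp y); last first.
    by have := gP _ _ (contract_arc axy nE); rewrite Eg eqxx.
  have /eqP := E; rewrite comp_eq.
  move=> /(connect_linked_arc irr noB niceCC axy)/linkedP[A [AC xA yA]].
  have nxy : x != y by apply: contraTneq axy => ->; rewrite irr.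
  by have := fP A AC x y xA yA; rewrite /und_adj nxy axy Ef eqxx => /(_ isT).
apply/existsP; exists [ffun x => col x]; apply/forallP => x; apply/forallP => y.
rewrite !ffunE; apply/implyP => /andP[_ /orP[/colP//|/colP]]; by rewrite eq_sym.
Qed.

End Main.

Theorem mainTheorem3 (T : finType) (a : rel T) (k : nat) :
  3 <= k -> irreflexive a -> strongly_connected a ->
  (2 * k - 2) * (2 * k - 3) < chi a ->
  contains_subdiv_B a k 1 1.
Proof.
move=> k_ge3 irr strong; rewrite /chi; case: ex_minnP => m _ min_m lt_m; apply: NNPP => noB.
have nice0 : nice a k set0 by apply/andP; split; apply/forall_inP => A; rewrite inE.
case: (arg_maxnP (fun D : {set {set T}} => #|D|) nice0) => CC niceCC maxCC.
have := min_m _ (nice_family_colorable k_ge3 irr strong noB niceCC maxCC).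
by rewrite leqNgt lt_m.
Qed.
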